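(* Every strongly $J^{\#}$-clean ring is strongly clean.
   Context: All rings are associative with identity, not necessarily commutative. $J(R)$ denotes the Jacobson radical of $R$ and $J^{\#}(R)=\{z\in R : z^n\in J(R)\text{ for some } n\ge 1\}$. A ring $R$ is strongly $J^{\#}$-clean if every $a\in R$ can be written $a=e+j$ with $e^2=e\in R$, $j\in J^{\#}(R)$ and $ej=je$. A ring $R$ is strongly clean if every $a\in R$ can be written $a=e+u$ with $e^2=e\in R$, $u$ a unit of $R$ and $eu=ue$. *)

(* Defs.v *)
From mathcomp Require Import all_boot all_algebra classical_sets.

Set Implicit Arguments.
Unset Strict Implicit.
Unset Printing Implicit Defensive.

Import GRing.Theory.
Local Open Scope classical_set_scope.
Local Open Scope ring_scope.

(* Rings are [pzRingType]: associative and unital, not necessarily            *)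
(* commutative, and possibly zero.  Ideals are Prop-valued, since ring_quotient *)
(* only covers decidable ideals of nonzero rings; likewise [two_sided_unit]   *)
(* replaces [GRing.unit], which needs units to be decidable.                  *)

Definition left_ideal (R : pzRingType) (I : set R) : Prop :=
  [/\ I 0,
      forall x y, I x -> I y -> I (x + y)
    & forall a x, I x -> I (a * x)].

Definition maximal_left_ideal (R : pzRingType) (M : set R) : Prop :=
  [/\ left_ideal M,
      M <> setT
    & forall I : set R, left_ideal I -> M `<=` I -> I = M \/ I = setT].

(* The zero ring has no maximal left ideal: its radical is the whole ring.    *)
Definition jacobson_radical (R : pzRingType) : set R :=
  \bigcap_(M in [set M : set R | maximal_left_ideal M]) M.

Definition Jsharp (R : pzRingType) : set R :=
  [set z | exists n : nat, (1 <= n)%N /\ jacobson_radical (z ^+ n)].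

Definition two_sided_unit (R : pzRingType) (u : R) : Prop :=
  exists v : R, u * v = 1 /\ v * u = 1.

Definition strongly_Jsharp_clean (R : pzRingType) : Prop :=
  forall a : R, exists e j : R,
    [/\ a = e + j, e ^+ 2 = e, Jsharp j & e * j = j * e].

Definition strongly_clean (R : pzRingType) : Prop :=
  forall a : R, exists e u : R,
    [/\ a = e + u, e ^+ 2 = e, two_sided_unit u & e * u = u * e].

(* Main.v *)
Require Import Defs.
From mathcomp Require Import all_boot all_algebra.
From mathcomp Require Import boolp classical_sets.

(** Write [a = e + j] as in the hypothesis and put [s = 2e - 1].  Then
    [a = (1 - e) + (s + j)] with [1 - e] idempotent, and everything in sight
    commutes, so it remains to see that [s + j] is a unit.  Since [s ^+ 2 = 1],
    [s + j = s * (1 + s * j)], so it suffices to treat [1 + s * j]; and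
    [- (s * j)] has a power in the Jacobson radical because [s] and [j] commute
    and the radical is a left ideal.  For such an element [w], the geometric sum
    reduces the invertibility of [1 - w] to that of [1 - w ^+ n].

    The remaining ingredient is that [1 - x] is invertible whenever [x] lies in
    the radical, the radical being defined by maximal left ideals.  If the left
    ideal generated by [1 - x] were proper, Zorn's lemma
    ([proper_left_ideal_sub_maximal]) would put it inside a maximal one, which
    would contain [x] and [1 - x], hence [1].  So [1 - x] has a left inverse
    [y]; but [y = 1 + y * x] is again of the form 1 minus a radical element, so
    [y] has a left inverse too, and left inverses are then two-sided. *)

Set Implicit Arguments.
Unset Strict Implicit.
Unset Printing Implicit Defensive.

Import GRing.Theory.
Local Open Scope classical_set_scope.
Local Open Scope ring_scope.

Lemma left_ideal_eqT (R : pzRingType) (I : set R) :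
  left_ideal I -> I 1 -> I = setT.
Proof.
move=> [_ _ IM] I1; apply/seteqP; split=> // x _.
by rewrite -[x]mulr1; apply: IM.
Qed.

Lemma left_ideal_principal (R : pzRingType) (a : R) :
  left_ideal [set r * a | r in setT].
Proof.
split.
- by exists 0; rewrite ?mul0r.
- by move=> _ _ [r _ <-] [s _ <-]; exists (r + s); rewrite ?mulrDl.
- by move=> b _ [r _ <-]; exists (b * r); rewrite ?mulrA.
Qed.

Lemma proper_left_ideal_sub_maximal (R : pzRingType) (I : set R) :
  left_ideal I -> ~ I 1 -> exists2 M : set R, maximal_left_ideal M & I `<=` M.
Proof.
move=> Iid I1; have [I0 ID IM] := Iid.
(* The empty chain has union [set0], which is not an ideal: the order is
   therefore put on sets [A] standing for the left ideal [I `|` A]. *)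
pose P (A : set R) := left_ideal (I `|` A) /\ ~ (I `|` A) 1.
have [F FP Ftot|A [[Aid A1] Amax]] := @Zorn_bigcup R P.
  have sub X : F X -> I `|` X `<=` I `|` \bigcup_(Y in F) Y.
    by move=> FX x [Ix|Xx]; [left|right; exists X].
  split; last by move=> [//|[X FX X1]]; have [_] := FP X FX; apply; right.
  split; first by left.
  - move=> x y [Ix|[X FX Xx]] [Iy|[Y FY Yy]].
    + by left; apply: ID.
    + by apply: (sub Y FY); have [[_ D _] _] := FP Y FY; apply: D; [left|right].
    + by apply: (sub X FX); have [[_ D _] _] := FP X FX; apply: D; [right|left].
    + have [XY|YX] := Ftot X Y FX FY.
        apply: (sub Y FY); have [[_ D _] _] := FP Y FY.
        by apply: D; right=> //; apply: XY.
      apply: (sub X FX); have [[_ D _] _] := FP X FX.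
      by apply: D; right=> //; apply: YX.
  - move=> a x [Ix|[X FX Xx]]; first by left; apply: IM.
    by apply: (sub X FX); have [[_ _ M] _] := FP X FX; apply: M; right.
exists (I `|` A); last by move=> x; left.
split=> //; first by move=> AT; apply: A1; rewrite AT.
move=> K Kid AK; have [K1|K1] := pselect (K 1).
  by right; apply: left_ideal_eqT.
have IK : I `|` K = K by apply/setUidPr => x Ix; apply: AK; left.
have AsubK : A `<=` K by move=> x Ax; apply: AK; right.
left; apply/seteqP; split=> // x Kx; right; apply: contrapT => Ax.
apply: (Amax K); last by rewrite /P IK.
by split=> [|/(_ x Kx)].
Qed.

Lemma jacobson_radicalMl (R : pzRingType) (a x : R) :
  jacobson_radical x -> jacobson_radical (a * x).
Proof. by move=> Jx M Mmax; have [[_ _ MM] _ _] := Mmax; apply: MM; apply: Jx. Qed.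

Lemma jacobson_radical_left_inverse (R : pzRingType) (x : R) :
  jacobson_radical x -> exists y, y * (1 - x) = 1.
Proof.
move=> Jx; have Iid := left_ideal_principal (1 - x).
apply: contrapT => noinv.
have [[y _ y1]|M Mmax IM] := proper_left_ideal_sub_maximal Iid.
  by apply: noinv; exists y.
have [Mid MT _] := Mmax; have [_ MD _] := Mid.
apply: MT; apply: left_ideal_eqT => //.
rewrite -[1](subrK x); apply: MD; last exact: Jx.
by apply: IM; exists 1; rewrite ?mul1r.
Qed.

Lemma jacobson_radical_unit (R : pzRingType) (x : R) :
  jacobson_radical x -> two_sided_unit (1 - x).
Proof.
move=> Jx; have [y yx] := jacobson_radical_left_inverse Jx.
have yE : 1 - (- y * x) = y.
  by rewrite mulNr opprK -{1}yx mulrBr mulr1 subrK.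
have [z] := jacobson_radical_left_inverse (jacobson_radicalMl (- y) Jx).
rewrite yE => zy; exists y; split=> //.
(* [z] and [1 - x] are a left and a right inverse of [y], hence equal. *)
have zE : z = 1 - x by rewrite -[z]mulr1 -{1}yx mulrA zy mul1r.
by rewrite -zE.
Qed.

(** The geometric sum [g] commutes with [1 - w], so an inverse of their product
    [1 - w ^+ n] yields inverses of [1 - w] on both sides. *)
Lemma Jsharp_unit (R : pzRingType) (w : R) :
  Jsharp w -> two_sided_unit (1 - w).
Proof.
move=> [n [_ Jw]]; have [v [wv vw]] := jacobson_radical_unit Jw.
pose g := \sum_(i < n) w ^+ i.
have wg : (1 - w) * g = 1 - w ^+ n by rewrite -opprB mulNr -subrX1 opprB.
have gw : g * (1 - w) = 1 - w ^+ n.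
  rewrite -wg; apply/commr_sym/commr_sum => i _.
  by apply/commr_sym/commrB; [apply: commr1|apply/commr_sym/commrX].
exists (g * v); split; first by rewrite mulrA wg.
(* [g * v] is a right inverse and [v * g] a left one. *)
have -> : g * v = v * g.
  by rewrite -[LHS]mul1r -vw -gw -!mulrA [(1 - w) * _]mulrA wg wv mulr1.
by rewrite -mulrA gw.
Qed.

Lemma Jsharp_commMl (R : pzRingType) (a j : R) :
  GRing.comm a j -> Jsharp j -> Jsharp (a * j).
Proof.
move=> aj [n [n1 Jj]]; exists n; split=> //.
by rewrite exprMn_comm //; apply: jacobson_radicalMl.
Qed.

Lemma two_sided_unitM (R : pzRingType) (a b : R) :
  two_sided_unit a -> two_sided_unit b -> two_sided_unit (a * b).
Proof.
move=> [a' [aa' a'a]] [b' [bb' b'b]]; exists (b' * a'); split.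
  by rewrite -mulrA (mulrA b) bb' mul1r.
by rewrite -mulrA (mulrA a') a'a mul1r.
Qed.

Theorem lemma2p19 (R : pzRingType) :
  strongly_Jsharp_clean R -> strongly_clean R.
Proof.
move=> Rclean a; have [e [j [-> e2 Jj ej]]] := Rclean a.
have ee : e * e = e by rewrite -expr2.
pose s := e - (1 - e).
have es : GRing.comm e s.
  by apply: commrB => //; apply: commrB => //; apply: commr1.
have sj : GRing.comm s j.
  by apply/commr_sym/commrB; [|apply: commrB; [apply: commr1|]]; apply/commr_sym.
have ef : e * (1 - e) = 0 by rewrite mulrBr mulr1 ee subrr.
have fe : (1 - e) * e = 0 by rewrite mulrBl mul1r ee subrr.
have ff : (1 - e) * (1 - e) = 1 - e by rewrite mulrBl mul1r ef subr0.
have ss : s * s = 1.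
  have se : s * e = e by rewrite /s (mulrBl e) ee fe subr0.
  have sf : s * (1 - e) = - (1 - e) by rewrite /s (mulrBl (1 - e)) ef ff sub0r.
  by rewrite {2}/s mulrBr se sf opprK addrC subrK.
exists (1 - e), (s + j); split.
- by rewrite addrA /s [1 - e + _]addrC subrK.
- by rewrite expr2.
- have -> : s + j = s * (1 - - s * j).
    by rewrite mulNr opprK mulrDr mulr1 mulrA ss mul1r.
  apply: two_sided_unitM; first by exists s.
  by apply/Jsharp_unit/Jsharp_commMl => //; apply/commr_sym/commrN/commr_sym.
- apply/commr_sym/commrB; first exact: commr1.
  by apply/commr_sym/commrD.
Qed.
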